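(* Let $n\ge1$ be an integer, let $(\mathscr{C},\mathbb{E},\mathfrak{s})$ be an $n$-exangulated category, let $\mathscr{A}$ be an abelian category, and let $F\colon\mathscr{C}\to\mathscr{A}$ be a half exact functor. For objects $X_0,X_{n+1}\in\mathscr{C}$ let $\mathbb{E}^F_R(X_{n+1},X_0)\subseteq\mathbb{E}(X_{n+1},X_0)$ be the subset of those $\delta$ such that for any distinguished $n$-exangle $X_0\xrightarrow{f_0}X_1\xrightarrow{f_1}\cdots\xrightarrow{f_{n-1}}X_n\xrightarrow{f_n}X_{n+1}\overset{\delta}{\dashrightarrow}$ the morphism $Ff_n$ is an epimorphism in $\mathscr{A}$. Then the following statements hold. (1) $\mathbb{E}^F_R$ is a closed subfunctor of $\mathbb{E}$; hence $(\mathscr{C},\mathbb{E}^F_R)$ is a relative theory of $(\mathscr{C},\mathbb{E},\mathfrak{s})$. (2) $F$ restricts to a right exact functor $F\colon(\mathscr{C},\mathbb{E}^F_R)\to\mathscr{A}$. (3) Let $(\mathscr{C},\mathbb{F})$ be a relative theory of $(\mathscr{C},\mathbb{E},\mathfrak{s})$. If $F$ restricts to a right exact functor $F\colon(\mathscr{C},\mathbb{F})\to\mathscr{A}$, then $\mathbb{F}\subseteq\mathbb{E}^F_R$.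
   Context: Fix an integer $n\ge1$. Let $\mathscr{C}$ be an additive category and $\mathbb{E}\colon\mathscr{C}^{\mathrm{op}}\times\mathscr{C}\to\mathsf{Ab}$ an additive bifunctor. An element $\delta\in\mathbb{E}(C,A)$ is called an extension. For $a\colon A\to A'$ and $c\colon C'\to C$ write $a_*\delta=\mathbb{E}(C,a)(\delta)\in\mathbb{E}(C,A')$ and $c^*\delta=\mathbb{E}(c,A)(\delta)\in\mathbb{E}(C',A)$. A morphism of extensions from $\delta\in\mathbb{E}(C,A)$ to $\delta'\in\mathbb{E}(C',A')$ is a pair $(a,c)$ with $a\colon A\to A'$, $c\colon C\to C'$ and $a_*\delta=c^*\delta'$. An extension $\delta\in\mathbb{E}(C,A)$ induces natural transformations $\delta_\sharp\colon\mathscr{C}(-,C)\Rightarrow\mathbb{E}(-,A)$, $f\mapsto f^*\delta$, and $\delta^\sharp\colon\mathscr{C}(A,-)\Rightarrow\mathbb{E}(C,-)$, $g\mapsto g_*\delta$. **Complexes.** Let $\mathbf{C}^{n+2}_{\mathscr{C}}$ be the category of complexes $X_\bullet\colon X_0\xrightarrow{d_0^X}X_1\to\cdots\to X_n\xrightarrow{d_n^X}X_{n+1}$ in $\mathscr{C}$ concentrated in degrees $0,\ldots,n+1$, with chain maps $f_\bullet=(f_0,\ldots,f_{n+1})$ as morphisms. Two complexes with the same end terms $X_0=Y_0=A$, $X_{n+1}=Y_{n+1}=C$ are homotopy equivalent if there are chain maps in both directions, which are identities in degrees $0$ and $n+1$, whose composites are chain homotopic to the identities; $[X_\bullet]$ denotes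 the resulting class. **$n$-exangles.** A pair $\langle X_\bullet,\delta\rangle$ with $X_\bullet\in\mathbf{C}^{n+2}_{\mathscr{C}}$ and $\delta\in\mathbb{E}(X_{n+1},X_0)$ is an $n$-exangle if the sequences of functors $\mathscr{C}(-,X_0)\to\cdots\to\mathscr{C}(-,X_{n+1})\xrightarrow{\delta_\sharp}\mathbb{E}(-,X_0)$ and $\mathscr{C}(X_{n+1},-)\to\cdots\to\mathscr{C}(X_0,-)\xrightarrow{\delta^\sharp}\mathbb{E}(X_{n+1},-)$ (with maps induced by the $d_i^X$) are exact. It is also written $X_0\to X_1\to\cdots\to X_{n+1}\overset{\delta}{\dashrightarrow}$. **Realizations.** A realization $\mathfrak{s}$ of $\mathbb{E}$ assigns to each $\delta\in\mathbb{E}(C,A)$ a homotopy equivalence class $\mathfrak{s}(\delta)=[X_\bullet]$ of complexes with $X_0=A$, $X_{n+1}=C$, such that (R0): whenever $\mathfrak{s}(\delta)=[X_\bullet]$, $\mathfrak{s}(\rho)=[Y_\bullet]$ and $(a,c)\colon\delta\to\rho$ is a morphism of extensions, there is a chain map $f_\bullet\colon X_\bullet\to Y_\bullet$ of the form $(a,f_1,\ldots,f_n,c)$, called a lift of $(a,c)$. It is exact if (R1): whenever $\mathfrak{s}(\delta)=[X_\bullet]$, $\langle X_\bullet,\delta\rangle$ is an $n$-exangle; and (R2): for every $A\in\mathscr{C}$, $\mathfrak{s}(0\in\mathbb{E}(0,A))=[A\xrightarrow{\mathrm{id}}A\to0\to\cdots\to0]$ and $\mathfrak{s}(0\in\mathbb{E}(A,0))=[0\to\cdots\to0\to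 A\xrightarrow{\mathrm{id}}A]$. If $\mathfrak{s}(\delta)=[X_\bullet]$, then $\langle X_\bullet,\delta\rangle$ is called a ($\mathfrak{s}$-)distinguished $n$-exangle and $X_\bullet$ a conflation. A morphism is an inflation (resp. deflation) if it equals $d_0^X$ (resp. $d_n^X$) for some conflation $X_\bullet$. **Mapping cone and cocone.** For $f_\bullet\colon X_\bullet\to Y_\bullet$ with $X_0=Y_0$ and $f_0=\mathrm{id}$, the mapping cone $M^f_\bullet$ is the complex $X_1\xrightarrow{d_0}X_2\oplus Y_1\xrightarrow{d_1}\cdots\to X_{n+1}\oplus Y_n\xrightarrow{d_n}Y_{n+1}$ with $d_0=\begin{bmatrix}-d_1^X\\ f_1\end{bmatrix}$, $d_i=\begin{bmatrix}-d_{i+1}^X&0\\ f_{i+1}&d_i^Y\end{bmatrix}$ for $1\le i\le n-1$, $d_n=\begin{bmatrix}f_{n+1}&d_n^Y\end{bmatrix}$. Dually, for $h_\bullet\colon X_\bullet\to Y_\bullet$ with $X_{n+1}=Y_{n+1}$ and $h_{n+1}=\mathrm{id}$, the mapping cocone $N^h_\bullet$ is the complex $X_0\to X_1\oplus Y_0\to X_2\oplus Y_1\to\cdots\to X_n\oplus Y_{n-1}\to Y_n$ with $d_0=\begin{bmatrix}d_0^X\\ h_0\end{bmatrix}$, $d_i=\begin{bmatrix}d_i^X&0\\ h_i&-d_{i-1}^Y\end{bmatrix}$ for $1\le i\le n-1$, $d_n=\begin{bmatrix}h_n&-d_{n-1}^Y\end{bmatrix}$. **$n$-exangulated category.** A triplet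 $(\mathscr{C},\mathbb{E},\mathfrak{s})$ with $\mathscr{C}$ an additive category, $\mathbb{E}\colon\mathscr{C}^{\mathrm{op}}\times\mathscr{C}\to\mathsf{Ab}$ an additive bifunctor and $\mathfrak{s}$ an exact realization of $\mathbb{E}$, satisfying: (EA1) inflations are closed under composition, and deflations are closed under composition. (EA2) For $\rho\in\mathbb{E}(D,A)$, $c\in\mathscr{C}(C,D)$ and distinguished $n$-exangles $\langle X_\bullet,c^*\rho\rangle$, $\langle Y_\bullet,\rho\rangle$, the morphism $(\mathrm{id}_A,c)$ has a lift $f_\bullet\colon X_\bullet\to Y_\bullet$ such that $\langle M^f_\bullet,(d_0^X)_*\rho\rangle$ is a distinguished $n$-exangle. (EA2$^{\mathrm{op}}$) The dual: for $\rho\in\mathbb{E}(C,A)$, $a\in\mathscr{C}(A,B)$ and distinguished $n$-exangles $\langle X_\bullet,\rho\rangle$, $\langle Y_\bullet,a_*\rho\rangle$, the morphism $(a,\mathrm{id}_C)$ has a lift $h_\bullet\colon X_\bullet\to Y_\bullet$ such that $\langle N^h_\bullet,(d_n^Y)^*\rho\rangle$ is a distinguished $n$-exangle. **Closed subfunctors and relative theories.** An additive subfunctor $\mathbb{F}\subseteq\mathbb{E}$ is called a closed subfunctor if $(\mathscr{C},\mathbb{F},\mathfrak{s}|_{\mathbb{F}})$ is an $n$-exangulated category, where $\mathfrak{s}|_{\mathbb{F}}$ is the restriction of $\mathfrak{s}$ to $\mathbb{F}$. It is a known fact (Herschend–Liu–Nakaoka) that for an additive subfunctor $\mathbb{F}$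 this is equivalent to $\mathfrak{s}|_{\mathbb{F}}$-inflations being closed under composition, and also to $\mathfrak{s}|_{\mathbb{F}}$-deflations being closed under composition. In this case $(\mathscr{C},\mathbb{F},\mathfrak{s}|_{\mathbb{F}})$, abbreviated $(\mathscr{C},\mathbb{F})$, is called a relative theory of $(\mathscr{C},\mathbb{E},\mathfrak{s})$. **Half exact and right exact functors.** An additive functor $F\colon\mathscr{C}\to\mathscr{A}$ from an $n$-exangulated category to an abelian category is half exact if for every distinguished $n$-exangle $X_0\xrightarrow{f_0}X_1\to\cdots\to X_n\xrightarrow{f_n}X_{n+1}\overset{\delta}{\dashrightarrow}$ the sequence $FX_0\xrightarrow{Ff_0}FX_1\to\cdots\to FX_n\xrightarrow{Ff_n}FX_{n+1}$ is exact (at the terms $FX_1,\ldots,FX_n$). It is right exact if moreover $Ff_n$ is an epimorphism for every distinguished $n$-exangle. For a relative theory $(\mathscr{C},\mathbb{F})$, the distinguished $n$-exangles are those $\langle X_\bullet,\delta\rangle$ that are $\mathfrak{s}$-distinguished with $\delta\in\mathbb{F}(X_{n+1},X_0)$. *)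

(* Defs.v *)
From HB Require Import structures.
From mathcomp Require Import all_boot all_algebra.
From mathcomp Require Import boolp classical_sets.

Set Implicit Arguments.
Unset Strict Implicit.
Unset Printing Implicit Defensive.

Import GRing.Theory.

Declare Scope cat_scope.
Delimit Scope cat_scope with cat.
Local Open Scope classical_set_scope.
Local Open Scope ring_scope.
Local Open Scope cat_scope.

(** Zero object and biproducts are chosen, since trivial complexes and mapping
    cones are built from them.  Another choice of biproducts gives mapping cones
    in the same homotopy class with fixed ends. *)
Record additive_category := AdditiveCategory {
  obj :> Type;
  hom : obj -> obj -> zmodType;
  idm : forall A, hom A A;
  comp : forall A B C, hom B C -> hom A B -> hom A C;
  comp1m : forall A B (f : hom A B), comp (idm B) f = f;
  compm1 : forall A B (f : hom A B), comp f (idm A) = f;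
  compA : forall A B C D (h : hom C D) (g : hom B C) (f : hom A B),
    comp h (comp g f) = comp (comp h g) f;
  compDl : forall A B C (g g' : hom B C) (f : hom A B),
    comp (g + g') f = comp g f + comp g' f;
  compDr : forall A B C (g : hom B C) (f f' : hom A B),
    comp g (f + f') = comp g f + comp g f';
  zob : obj;
  zob_initial : forall A (f : hom zob A), f = 0;
  zob_terminal : forall A (f : hom A zob), f = 0;
  biprod : obj -> obj -> obj;
  in1 : forall A B, hom A (biprod A B);
  in2 : forall A B, hom B (biprod A B);
  pr1 : forall A B, hom (biprod A B) A;
  pr2 : forall A B, hom (biprod A B) B;
  pr1_in1 : forall A B, comp (pr1 A B) (in1 A B) = idm A;
  pr2_in2 : forall A B, comp (pr2 A B) (in2 A B) = idm B;
  pr1_in2 : forall A B, comp (pr1 A B) (in2 A B) = 0;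
  pr2_in1 : forall A B, comp (pr2 A B) (in1 A B) = 0;
  biprod_id : forall A B,
    comp (in1 A B) (pr1 A B) + comp (in2 A B) (pr2 A B) = idm (biprod A B)
}.

Arguments hom {a}.
Arguments idm {a}.
Arguments zob {a}.
Arguments biprod {a}.
Arguments in1 {a}.
Arguments in2 {a}.
Arguments pr1 {a}.
Arguments pr2 {a}.

Notation "g ∘ f" := (comp g f) (at level 40, left associativity) : cat_scope.
Notation "A ⊞ B" := (biprod A B) (at level 50, left associativity) : cat_scope.

Section Morphisms.
Variable Cat : additive_category.
Implicit Types A B C D : Cat.

(** [colm f g] is the column matrix with entries [f], [g]; [rowm f g] is the
    row matrix; [blockm a b c d] has first row [a b] and second row [c d]. *)
Definition colm A B C (f : hom A B) (g : hom A C) : hom A (B ⊞ C) :=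
  in1 B C ∘ f + in2 B C ∘ g.

Definition rowm A B C (f : hom A C) (g : hom B C) : hom (A ⊞ B) C :=
  f ∘ pr1 A B + g ∘ pr2 A B.

Definition blockm A B C D (a : hom A C) (b : hom B C) (c : hom A D)
    (d : hom B D) : hom (A ⊞ B) (C ⊞ D) :=
  colm (rowm a b) (rowm c d).

Definition is_mono A B (f : hom A B) : Prop :=
  forall Z (g h : hom Z A), f ∘ g = f ∘ h -> g = h.

Definition is_epi A B (f : hom A B) : Prop :=
  forall Z (g h : hom B Z), g ∘ f = h ∘ f -> g = h.

Definition is_kernel K A B (k : hom K A) (f : hom A B) : Prop :=
  f ∘ k = 0 /\
  forall Z (g : hom Z A), f ∘ g = 0 -> exists! u : hom Z K, k ∘ u = g.

Definition is_cokernel A B Q (q : hom B Q) (f : hom A B) : Prop :=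
  q ∘ f = 0 /\
  forall Z (g : hom B Z), g ∘ f = 0 -> exists! u : hom Q Z, u ∘ q = g.

Definition is_image A B I (m : hom I B) (f : hom A B) : Prop :=
  exists Q (q : hom B Q), is_cokernel q f /\ is_kernel m q.

(** The image of [f] and the kernel of [g] are the same subobject of [B]. *)
Definition exact_pair A B C (f : hom A B) (g : hom B C) : Prop :=
  exists K (k : hom K B), is_image k f /\ is_kernel k g.

Lemma comp0m A B C (f : hom A B) : (0 : hom B C) ∘ f = 0.
Proof. by apply: (@addrI _ (0 ∘ f)); rewrite -compDl !addr0. Qed.

Lemma compm0 A B C (g : hom B C) : g ∘ (0 : hom A B) = 0.
Proof. by apply: (@addrI _ (g ∘ 0)); rewrite -compDr !addr0. Qed.

Lemma compNm A B C (g : hom B C) (f : hom A B) : (- g) ∘ f = - (g ∘ f).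
Proof. by apply: (@addrI _ (g ∘ f)); rewrite -compDl !subrr comp0m. Qed.

Lemma compmN A B C (g : hom B C) (f : hom A B) : g ∘ (- f) = - (g ∘ f).
Proof. by apply: (@addrI _ (g ∘ f)); rewrite -compDr !subrr compm0. Qed.

Lemma pr1_colm A B C (f : hom A B) (g : hom A C) : pr1 B C ∘ colm f g = f.
Proof. by rewrite compDr !compA pr1_in1 pr1_in2 comp1m comp0m addr0. Qed.

Lemma pr2_colm A B C (f : hom A B) (g : hom A C) : pr2 B C ∘ colm f g = g.
Proof. by rewrite compDr !compA pr2_in1 pr2_in2 comp1m comp0m add0r. Qed.

Lemma rowm_colm A B C D (f : hom A B) (g : hom A C) (h : hom B D)
  (k : hom C D) : rowm h k ∘ colm f g = h ∘ f + k ∘ g.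
Proof. by rewrite compDl -!compA pr1_colm pr2_colm. Qed.

Lemma rowm_colm_eq0 Z A B C D (f : hom A B) (g : hom A C) (h : hom B D)
    (k : hom C D) (m : hom Z A) :
  h ∘ f + k ∘ g = 0 -> rowm h k ∘ (colm f g ∘ m) = 0.
Proof. by move=> e; rewrite compA rowm_colm e comp0m. Qed.

Lemma colm_comp Z A B C (f : hom A B) (g : hom A C) (h : hom Z A) :
  colm f g ∘ h = colm (f ∘ h) (g ∘ h).
Proof. by rewrite compDl -!compA. Qed.

Lemma colm0 A B C : colm (0 : hom A B) (0 : hom A C) = 0.
Proof. by rewrite /colm !compm0 addr0. Qed.

Lemma blockm_colm_eq0 Z A B C A' B' (f : hom Z A) (g : hom Z B)
    (a : hom A A') (b : hom B A') (c : hom A B') (d : hom B B') (m : hom C Z) :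
  a ∘ f + b ∘ g = 0 -> c ∘ f + d ∘ g = 0 ->
  blockm a b c d ∘ (colm f g ∘ m) = 0.
Proof.
by move=> e e'; rewrite compA colm_comp !rowm_colm e e' colm0 comp0m.
Qed.

Lemma rowm_blockm_eq0 Z A B A' B' (h : hom A' Z) (k : hom B' Z)
    (a : hom A A') (b : hom B A') (c : hom A B') (d : hom B B') :
  h ∘ a + k ∘ c = 0 -> h ∘ b + k ∘ d = 0 -> rowm h k ∘ blockm a b c d = 0.
Proof.
move=> e e'; rewrite rowm_colm /rowm !compDr !compA addrACA -!compDl e e'.
by rewrite !comp0m addr0.
Qed.

Lemma blockm_blockm_eq0 A B A' B' A2 B2
    (a : hom A A') (b : hom B A') (c : hom A B') (d : hom B B')
    (a' : hom A' A2) (b' : hom B' A2) (c' : hom A' B2) (d' : hom B' B2) :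
  a' ∘ a + b' ∘ c = 0 -> a' ∘ b + b' ∘ d = 0 ->
  c' ∘ a + d' ∘ c = 0 -> c' ∘ b + d' ∘ d = 0 ->
  blockm a' b' c' d' ∘ blockm a b c d = 0.
Proof.
by move=> *; rewrite [X in X ∘ _]/blockm colm_comp !rowm_blockm_eq0 ?colm0.
Qed.

Definition idm_or_0 (T : nat -> Cat) (k l : nat) : hom (T k) (T l) :=
  if eqnP is ReflectT e
  then ecast z (hom (T k) (T z)) e (idm (T k)) else 0.

End Morphisms.

Record abelian_category := AbelianCategory {
  ab_cat :> additive_category;
  has_kernel : forall (A B : ab_cat) (f : hom A B),
    exists K (k : hom K A), is_kernel k f;
  has_cokernel : forall (A B : ab_cat) (f : hom A B),
    exists Q (q : hom B Q), is_cokernel q f;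
  mono_is_kernel : forall (A B : ab_cat) (f : hom A B),
    is_mono f -> exists C (g : hom B C), is_kernel f g;
  epi_is_cokernel : forall (A B : ab_cat) (f : hom A B),
    is_epi f -> exists C (g : hom C A), is_cokernel f g
}.

Record additive_functor (Cat Cat' : additive_category) := AdditiveFunctor {
  fob :> Cat -> Cat';
  fmap : forall A B, hom A B -> hom (fob A) (fob B);
  fmap1 : forall A, fmap (idm A) = idm (fob A);
  fmap_comp : forall A B C (g : hom B C) (f : hom A B),
    fmap (g ∘ f) = fmap g ∘ fmap f;
  fmapD : forall A B (f g : hom A B), fmap (f + g) = fmap f + fmap g
}.

(** Complexes live in degrees [0, ..., n+1].  The term of degree [i] is written
    [X i j], where [j] is the codegree and [i + j = n + 1].  Recording both
    indices makes [X 0 n.+1] convertible to the left end and [X n.+1 0] to the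
    right end, so that complexes with prescribed ends need no transport.  The
    differential of degree [i] is [diff X i j] with [i + j = n].  Values of [X],
    [diff X] and of components of chain maps and homotopies at other pairs of
    indices carry no meaning, and no notion below depends on them. *)
Section Complexes.
Variables (Cat : additive_category) (n : nat).
Implicit Types A B C D : Cat.

Definition pad A C (mid : nat -> nat -> Cat) (i j : nat) : Cat :=
  match i, j with
  | 0, _ => A
  | _.+1, 0 => C
  | _.+1, _.+1 => mid i j
  end.

Record cplx A C := Cplx {
  mid : nat -> nat -> Cat;
  diff : forall i j, hom (pad A C mid i j.+1) (pad A C mid i.+1 j);
  diff_diff : forall i j, (i + j).+1 = n -> diff i.+1 j ∘ diff i j.+1 = 0
}.

Definition term A C (X : cplx A C) : nat -> nat -> Cat := pad A C (mid X).
Local Coercion term : cplx >-> Funclass.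

Record chain_map A C A' C' (X : cplx A C) (Y : cplx A' C') := ChainMap {
  cm : forall i j, hom (X i j) (Y i j);
  cm_diff : forall i j, (i + j)%N = n ->
    cm i.+1 j ∘ diff X i j = diff Y i j ∘ cm i j.+1
}.

Definition has_ends A C A' C' (X : cplx A C) (Y : cplx A' C')
    (f : chain_map X Y) (a : hom A A') (c : hom C C') : Prop :=
  cm f 0 n.+1 = a /\ cm f n.+1 0 = c.

(** [g] and [f] compose to a chain map homotopic to the identity of [X]; the
    homotopy [phi] has components [phi i j : X_{i+1} -> X_i] for [i + j = n]. *)
Definition homotopic_to_id A C A' C' (X : cplx A C) (Y : cplx A' C')
    (f : chain_map X Y) (g : chain_map Y X) : Prop :=
  exists phi : forall i j, hom (X i.+1 j) (X i j.+1),
  [/\ cm g 0 n.+1 ∘ cm f 0 n.+1 - idm A = phi 0%N n ∘ diff X 0 n,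
      forall i j, (i + j).+1 = n ->
        cm g i.+1 j.+1 ∘ cm f i.+1 j.+1 - idm (X i.+1 j.+1) =
        diff X i j.+1 ∘ phi i j.+1 + phi i.+1 j ∘ diff X i.+1 j
    & cm g n.+1 0 ∘ cm f n.+1 0 - idm C = diff X n 0 ∘ phi n 0%N].

Definition homotopy_equivalent A C (X Y : cplx A C) : Prop :=
  exists (f : chain_map X Y) (g : chain_map Y X),
  [/\ has_ends f (idm A) (idm C), has_ends g (idm A) (idm C),
      homotopic_to_id f g & homotopic_to_id g f].

(** [A = A -> 0 -> ... -> 0] *)
Section TrivialLeft.
Variable A : Cat.

Definition trivl_mid (i j : nat) : Cat := if i is 1 then A else zob.

Definition trivl_diff i j :
    hom (pad A zob trivl_mid i j.+1) (pad A zob trivl_mid i.+1 j) :=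
  match i, j with
  | 0, _.+1 => idm A
  | _, _ => 0
  end.

Lemma trivl_diffK i j : (i + j).+1 = n ->
  trivl_diff i.+1 j ∘ trivl_diff i j.+1 = 0.
Proof. by move=> _; rewrite comp0m. Qed.

Definition trivl : cplx A zob := Cplx trivl_diffK.
End TrivialLeft.

(** [0 -> ... -> 0 -> A = A] *)
Section TrivialRight.
Variable A : Cat.

Definition trivr_mid (i j : nat) : Cat := if j is 1 then A else zob.

Definition trivr_diff i j :
    hom (pad zob A trivr_mid i j.+1) (pad zob A trivr_mid i.+1 j) :=
  match i, j with
  | _.+1, 0 => idm A
  | _, _ => 0
  end.

Lemma trivr_diffK i j : (i + j).+1 = n ->
  trivr_diff i.+1 j ∘ trivr_diff i j.+1 = 0.
Proof. by move=> _; case: i j => [|i] [|j]; rewrite /= ?comp1m ?comp0m. Qed.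

Definition trivr : cplx zob A := Cplx trivr_diffK.
End TrivialRight.

(** In degree [0] the cone starts at [X 1 n], whereas the matrix starts at
    [X 1 j.+1], where [j.+1 = n]; [idm_or_0] identifies the two.  The value at
    [i = j = 0] is irrelevant as soon as [0 < n].  Forming the cone does not
    require [f] to be the identity in degree [0]. *)
Section MappingCone.
Variables (A C D : Cat) (X : cplx A C) (Y : cplx A D) (f : chain_map X Y).

Definition cone_mid (i j : nat) : Cat := X i.+1 j.-1 ⊞ Y i j.

Definition cone_diff i j :
    hom (pad (X 1%N n) D cone_mid i j.+1) (pad (X 1%N n) D cone_mid i.+1 j) :=
  match i, j with
  | 0, 0 => 0
  | 0, j.+1 => colm (- diff X 1 j) (cm f 1 j.+1) ∘ idm_or_0 (X 1%N) n j.+1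
  | i.+1, 0 => rowm (cm f i.+2 0) (diff Y i.+1 0)
  | i.+1, j.+1 =>
      blockm (- diff X i.+2 j) 0 (cm f i.+2 j.+1) (diff Y i.+1 j.+1)
  end.

Lemma cone_diffK i j : (i + j).+1 = n -> cone_diff i.+1 j ∘ cone_diff i j.+1 = 0.
Proof.
have dX k l : (k + l).+1 = n -> (- diff X k.+1 l) ∘ (- diff X k l.+1) = 0.
  by move=> e; rewrite compmN compNm diff_diff // !oppr0.
have fd k l : (k + l)%N = n ->
    cm f k.+1 l ∘ (- diff X k l) + diff Y k l ∘ cm f k l.+1 = 0.
  by move=> e; rewrite compmN cm_diff // addNr.
have dY k l : (k + l).+1 = n ->
    cm f k.+2 l ∘ 0 + diff Y k.+1 l ∘ diff Y k l.+1 = 0.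
  by move=> e; rewrite compm0 add0r diff_diff.
case: i j => [|i] [|j] e.
- by apply: rowm_colm_eq0; apply: (fd 1%N 0%N).
- apply: blockm_colm_eq0; last exact: (fd 1%N j.+1).
  by rewrite comp0m addr0; apply: (dX 1%N); rewrite -e addnS.
- apply: rowm_blockm_eq0; first by apply: (fd i.+2 0%N); rewrite -e.
  by apply: (dY i.+1 0%N); rewrite -e.
- apply: blockm_blockm_eq0.
  + by rewrite comp0m addr0; apply: (dX i.+2); rewrite -e !addnS.
  + by rewrite compm0 comp0m addr0.
  + by apply: (fd i.+2 j.+1); rewrite -e.
  + by apply: (dY i.+1 j.+1); rewrite -e.
Qed.

Definition cone : cplx (X 1%N n) D := Cplx cone_diffK.
End MappingCone.

Section MappingCocone.
Variables (A B C : Cat) (X : cplx A C) (Y : cplx B C) (h : chain_map X Y).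

Definition cocone_mid (i j : nat) : Cat := X i j ⊞ Y i.-1 j.+1.

Definition cocone_diff i j :
    hom (pad A (Y n 1%N) cocone_mid i j.+1) (pad A (Y n 1%N) cocone_mid i.+1 j) :=
  match i, j with
  | 0, 0 => 0
  | 0, j.+1 => colm (diff X 0 j.+1) (cm h 0 j.+2)
  | i.+1, 0 =>
      idm_or_0 (Y^~ 1%N) i.+1 n ∘ rowm (cm h i.+1 1) (- diff Y i 1)
  | i.+1, j.+1 =>
      blockm (diff X i.+1 j.+1) 0 (cm h i.+1 j.+2) (- diff Y i j.+2)
  end.

Lemma cocone_diffK i j : (i + j).+1 = n ->
  cocone_diff i.+1 j ∘ cocone_diff i j.+1 = 0.
Proof.
have dY k l : (k + l).+1 = n -> (- diff Y k.+1 l) ∘ (- diff Y k l.+1) = 0.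
  by move=> e; rewrite compmN compNm diff_diff // !oppr0.
have hd k l : (k + l)%N = n ->
    cm h k.+1 l ∘ diff X k l + (- diff Y k l) ∘ cm h k l.+1 = 0.
  by move=> e; rewrite compNm cm_diff // subrr.
have dX k l : (k + l).+1 = n ->
    diff X k.+1 l ∘ diff X k l.+1 + 0 ∘ cm h k l.+2 = 0.
  by move=> e; rewrite comp0m addr0 diff_diff.
case: i j => [|i] [|j] e.
- rewrite -[LHS]compA -[X in _ ∘ (_ ∘ X)]compm1 rowm_colm_eq0 ?compm0 //.
  exact: (hd 0%N 1%N).
- rewrite -[X in _ ∘ X]compm1; apply: blockm_colm_eq0; first exact: (dX 0%N j.+1).
  by apply: (hd 0%N j.+2); rewrite -e.
- rewrite -[LHS]compA rowm_blockm_eq0 ?compm0 ?add0r //.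
    by apply: (hd i.+1 1%N); rewrite -e addnS.
  by apply: (dY i 1%N); rewrite -e addnS.
- apply: blockm_blockm_eq0.
  + by rewrite comp0m addr0; apply: diff_diff; rewrite -e.
  + by rewrite compm0 comp0m addr0.
  + by apply: (hd i.+1 j.+2); rewrite -e addnS.
  + by rewrite compm0 add0r; apply: (dY i j.+2); rewrite -e !addnS.
Qed.

Definition cocone : cplx A (Y n 1%N) := Cplx cocone_diffK.
End MappingCocone.

End Complexes.

Coercion term : cplx >-> Funclass.

(** [ext E C A] is the group written E(C, A); [push a] is [a_*] and [pull c]
    is [c^*]. *)
Record bifunctor (Cat : additive_category) := Bifunctor {
  ext :> Cat -> Cat -> zmodType;
  push : forall C A A', hom A A' -> ext C A -> ext C A';
  pull : forall C C' A, hom C' C -> ext C A -> ext C' A;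
  pushD : forall C A A' (a : hom A A') (d d' : ext C A),
    push a (d + d') = push a d + push a d';
  pullD : forall C C' A (c : hom C' C) (d d' : ext C A),
    pull c (d + d') = pull c d + pull c d';
  push1 : forall C A (d : ext C A), push (idm A) d = d;
  pull1 : forall C A (d : ext C A), pull (idm C) d = d;
  push_comp : forall C A A' A'' (a' : hom A' A'') (a : hom A A') (d : ext C A),
    push (a' ∘ a) d = push a' (push a d);
  pull_comp : forall C C' C'' A (c : hom C' C) (c' : hom C'' C') (d : ext C A),
    pull (c ∘ c') d = pull c' (pull c d);
  push_pull : forall C C' A A' (a : hom A A') (c : hom C' C) (d : ext C A),
    push a (pull c d) = pull c (push a d);
  push_addm : forall C A A' (a a' : hom A A') (d : ext C A),
    push (a + a') d = push a d + push a' d;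
  pull_addm : forall C C' A (c c' : hom C' C) (d : ext C A),
    pull (c + c') d = pull c d + pull c' d
}.

Definition subfamily (Cat : additive_category) (E : bifunctor Cat) : Type :=
  forall C A : Cat, set (E C A).

Record additive_subfunctor (Cat : additive_category) (E : bifunctor Cat)
    (G : subfamily E) : Prop := AdditiveSubfunctor {
  sub0 : forall C A, G C A 0;
  subB : forall C A (d d' : E C A), G C A d -> G C A d' -> G C A (d - d');
  sub_push : forall C A A' (a : hom A A') (d : E C A),
    G C A d -> G C A' (push a d);
  sub_pull : forall C C' A (c : hom C' C) (d : E C A),
    G C A d -> G C' A (pull c d)
}.

Section SubBifunctor.
Variables (Cat : additive_category) (E : bifunctor Cat).
Variable G : subfamily E.
Arguments G : clear implicits.
Hypothesis hG : additive_subfunctor G.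

Definition sub_pred of additive_subfunctor G :=
  fun C A : Cat => [pred d : E C A | d \in G C A].

Lemma sub_predE C A d : (d \in sub_pred hG C A) = (d \in G C A).
Proof. by []. Qed.

Lemma sub_pred_closed C A : zmod_closed (sub_pred hG C A).
Proof.
split=> [|d d']; rewrite !sub_predE; first exact/mem_set/(sub0 hG).
by move=> /set_mem Gd /set_mem Gd'; apply/mem_set/(subB hG).
Qed.

HB.instance Definition _ C A :=
  GRing.isZmodClosed.Build (E C A) (sub_pred hG C A) (sub_pred_closed C A).

Definition sub_ext C A := {d : E C A | sub_pred hG C A d}.
HB.instance Definition _ C A := SubChoice.on (sub_ext C A).
HB.instance Definition _ C A :=
  [SubChoice_isSubZmodule of sub_ext C A by <:].

Lemma sub_push_mem C A A' (a : hom A A') (d : sub_ext C A) :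
  sub_pred hG C A' (push a (val d)).
Proof. by apply/mem_set/(sub_push hG)/set_mem/(valP d). Qed.

Lemma sub_pull_mem C C' A (c : hom C' C) (d : sub_ext C A) :
  sub_pred hG C' A (pull c (val d)).
Proof. by apply/mem_set/(sub_pull hG)/set_mem/(valP d). Qed.

Definition sub_pushm C A A' (a : hom A A') (d : sub_ext C A) : sub_ext C A' :=
  Sub _ (sub_push_mem a d).

Definition sub_pullm C C' A (c : hom C' C) (d : sub_ext C A) : sub_ext C' A :=
  Sub _ (sub_pull_mem c d).

Definition sub_bifunctor : bifunctor Cat.
Proof.
apply: (@Bifunctor Cat sub_ext sub_pushm sub_pullm) => *; apply: val_inj;
  rewrite /= ?raddfD /=.
- exact: pushD.
- exact: pullD.
- exact: push1.
- exact: pull1.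
- exact: push_comp.
- exact: pull_comp.
- exact: push_pull.
- exact: push_addm.
- exact: pull_addm.
Defined.

End SubBifunctor.

Definition exact_at (U V W : zmodType) (f : U -> V) (g : V -> W) : Prop :=
  forall v, g v = 0 <-> exists u, f u = v.

Section Exangulated.
Variables (Cat : additive_category) (E : bifunctor Cat) (n : nat).
Implicit Types A B C D : Cat.

Definition n_exangle A C (X : cplx n A C) (d : E C A) : Prop :=
  [/\ forall W i j, (i + j).+1 = n ->
        exact_at (fun u : hom W (X i j.+2) => diff X i j.+1 ∘ u)
                 (fun v : hom W (X i.+1 j.+1) => diff X i.+1 j ∘ v),
      forall W, exact_at (fun u : hom W (X n 1%N) => diff X n 0 ∘ u)
                         (fun v : hom W C => pull v d),
      forall W i j, (i + j).+1 = n ->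
        exact_at (fun u : hom (X i.+2 j) W => u ∘ diff X i.+1 j)
                 (fun v : hom (X i.+1 j.+1) W => v ∘ diff X i j.+1)
    & forall W, exact_at (fun u : hom (X 1%N n) W => u ∘ diff X 0 n)
                         (fun v : hom A W => push v d)].

(** [s d] is the class assigned to the extension [d], as a set of complexes;
    [s d X] reads [s(d) = [X]], that is, [X] with [d] is distinguished. *)
Definition class_assignment : Type :=
  forall C A (d : E C A), set (cplx n A C).

Variable s : class_assignment.
Arguments s {C A} d.

Record realization : Prop := Realization {
  rlz_class : forall C A (d : E C A),
    exists X : cplx n A C, s d = [set Y | homotopy_equivalent X Y];
  rlz_lift : forall C A C' A' (d : E C A) (r : E C' A')
      (X : cplx n A C) (Y : cplx n A' C') (a : hom A A') (c : hom C C'),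
    s d X -> s r Y -> push a d = pull c r ->
    exists f : chain_map X Y, has_ends f a c
}.

Record exact_realization : Prop := ExactRealization {
  xr_realization : realization;
  xr_exangle : forall C A (d : E C A) (X : cplx n A C),
    s d X -> n_exangle X d;
  xr_trivl : forall A, s (0 : E zob A) (trivl n A);
  xr_trivr : forall A, s (0 : E A zob) (trivr n A)
}.

Inductive inflation : forall A B, hom A B -> Prop :=
| Inflation C A (d : E C A) (X : cplx n A C) :
    s d X -> @inflation A (X 1%N n) (diff X 0 n).

Inductive deflation : forall A B, hom A B -> Prop :=
| Deflation C A (d : E C A) (X : cplx n A C) :
    s d X -> @deflation (X n 1%N) C (diff X n 0).

Record n_exangulated : Prop := NExangulated {
  nx_exact : exact_realization;
  nx_infl_comp : forall A B C (f : hom A B) (g : hom B C),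
    inflation f -> inflation g -> inflation (g ∘ f);
  nx_defl_comp : forall A B C (f : hom A B) (g : hom B C),
    deflation f -> deflation g -> deflation (g ∘ f);
  nx_cone : forall A C D (r : E D A) (c : hom C D)
      (X : cplx n A C) (Y : cplx n A D),
    s (pull c r) X -> s r Y ->
    exists f : chain_map X Y,
      has_ends f (idm A) c /\ s (push (diff X 0 n) r) (cone f);
  nx_cocone : forall A B C (r : E C A) (a : hom A B)
      (X : cplx n A C) (Y : cplx n B C),
    s r X -> s (push a r) Y ->
    exists h : chain_map X Y,
      has_ends h a (idm C) /\ s (pull (diff Y n 0) r) (cocone h)
}.

Definition half_exact (Ab : abelian_category) (F : additive_functor Cat Ab) :
    Prop :=
  forall C A (d : E C A) (X : cplx n A C), s d X ->
  forall i j, (i + j).+1 = n ->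
    exact_pair (fmap F (diff X i j.+1)) (fmap F (diff X i.+1 j)).

Definition right_exact (Ab : abelian_category) (F : additive_functor Cat Ab) :
    Prop :=
  half_exact F /\
  forall C A (d : E C A) (X : cplx n A C), s d X -> is_epi (fmap F (diff X n 0)).

Definition restrict (G : subfamily E) (hG : additive_subfunctor G) C A
    (d : sub_bifunctor hG C A) : set (cplx n A C) :=
  s (val (d : sub_ext hG C A)).

End Exangulated.

Arguments restrict {Cat E n} s {G} hG C A d.

(** A proof of [closed_subfunctor s G] amounts to a relative theory, whose
    distinguished n-exangles are given by [relative_theory]. *)
Record closed_subfunctor (Cat : additive_category) (E : bifunctor Cat) (n : nat)
    (s : class_assignment E n) (G : subfamily E) : Prop := ClosedSubfunctor {
  cs_additive : additive_subfunctor G;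
  cs_n_exangulated : n_exangulated (restrict s cs_additive)
}.

Definition relative_theory (Cat : additive_category) (E : bifunctor Cat)
    (n : nat) (s : class_assignment E n) (G : subfamily E)
    (hG : closed_subfunctor s G) :
    class_assignment (sub_bifunctor (cs_additive hG)) n :=
  restrict s (cs_additive hG).

Arguments relative_theory {Cat E n s G} hG C A d.

Definition right_exact_part (Cat : additive_category) (E : bifunctor Cat)
    (n : nat) (s : class_assignment E n) (Ab : abelian_category)
    (F : additive_functor Cat Ab) : subfamily E :=
  fun C A => [set d | forall X : cplx n A C, s C A d X ->
                        is_epi (fmap F (diff X n 0))].

Arguments right_exact_part {Cat E n} s {Ab} F C A _.

(* Main.v *)
Require Import Defs.
From mathcomp Require Import all_boot all_algebra.
From mathcomp Require Import boolp classical_sets.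

(** Write E_R for the subfamily in question.  Everything follows from a
    description of E_R that no longer mentions realizations: an extension lies
    in E_R if and only if it is killed by pulling back along some [t] such that
    [F t] is an epimorphism ([right_exact_partP]).  Indeed the morphisms that
    kill an extension are exactly those that factor through the deflation of
    any of its realizations.

    The one closure property that uses half exactness is stability under
    pullback ([right_exact_part_pull]).  (EA2) gives a distinguished mapping
    cone ending in X_n + Y_(n-1) -> C' + Y_n -> C; applying F to it gives an
    exact sequence, which turns surjectivity of F d_n^Y into surjectivity of
    F d_n^X.  With this, being in E_R is a local condition
    ([right_exact_part_local]): it may be tested after pulling back along any
    [t] with [F t] epi.  Differences are then handled by killing the two
    extensions one after the other, and pushforward and zero are clear, so E_R
    is an additive subfunctor.

    The axioms of an n-exangulated category other than closure of inflations and
    of deflations under composition pass to every additive subfunctor G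
    ([n_exangulated_restrict]).  A composite of deflations of E_R is a deflation
    whose image under F is epi, hence a deflation of E_R.  An inflation f is one
    of G if and only if G contains all extensions killed by f_*, because these
    are the pullbacks of any extension that has f as its inflation
    ([push_inflation_eq0], [inflation_restrictP]).  So let f and g have this
    property for E_R, and let g_* f_* gamma = 0.  Then f_* gamma is in E_R, hence
    t^* f_* gamma = 0 for some t with F t epi.  Now f_* kills t^* gamma, which is
    therefore in E_R, and gamma is in E_R by locality. *)

Section RightExactPart.
Set Implicit Arguments.
Unset Strict Implicit.
Unset Printing Implicit Defensive.
Import GRing.Theory Defs.
Local Open Scope classical_set_scope.
Local Open Scope ring_scope.
Local Open Scope cat_scope.

(** * Epimorphisms and exactness in abelian categories *)

Lemma is_epi0 (Cat : additive_category) (A B : Cat) (f : hom A B) :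
  (forall Z (g : hom B Z), g ∘ f = 0 -> g = 0) -> is_epi f.
Proof.
move=> f0 Z g h e; apply/subr0_eq/f0.
by rewrite compDl compNm e subrr.
Qed.

Lemma is_epi_eq0 (Cat : additive_category) (A B Z : Cat) (f : hom A B)
  (g : hom B Z) : is_epi f -> g ∘ f = 0 -> g = 0.
Proof. by move=> fP e; apply: fP; rewrite comp0m. Qed.

Lemma is_mono0 (Cat : additive_category) (A B : Cat) (f : hom A B) :
  (forall Z (g : hom Z A), f ∘ g = 0 -> g = 0) -> is_mono f.
Proof.
move=> f0 Z g h e; apply/subr0_eq/f0.
by rewrite compDr compmN e subrr.
Qed.

Lemma is_epi_comp (Cat : additive_category) (A B C : Cat) (f : hom A B)
  (g : hom B C) : is_epi f -> is_epi g -> is_epi (g ∘ f).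
Proof. by move=> fP gP Z h k; rewrite !compA => /fP /gP. Qed.

Lemma is_epi_factor (Cat : additive_category) (A B C : Cat) (f : hom A B)
  (g : hom B C) : is_epi (g ∘ f) -> is_epi g.
Proof. by move=> gfP Z h k e; apply: gfP; rewrite !compA e. Qed.

Lemma cokernel_epi (Cat : additive_category) (A B Q : Cat) (q : hom B Q)
  (f : hom A B) : is_cokernel q f -> is_epi q.
Proof.
move=> [qf qU] Z g h e.
have [|u [_ uU]] := qU Z (h ∘ q); first by rewrite -compA qf compm0.
by rewrite -(uU g e) -(uU h erefl).
Qed.

Lemma fmap0 (Cat Cat' : additive_category) (F : additive_functor Cat Cat')
  (A B : Cat) : fmap F (0 : hom A B) = 0.
Proof. by apply: (@addrI _ (fmap F 0)); rewrite -fmapD !addr0. Qed.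

(** An exact pair [f], [g] makes the middle term modulo [f] a subobject of the
    target of [g].  The mono is obtained without pullbacks: an [x] killed by
    [m] is killed by its cokernel [p], and [p] is a split mono, because the epi
    [p ∘ q] is the cokernel of something that [g], hence [q], kills. *)
Lemma exact_pair_factor (Ab : abelian_category) (A B C : Ab) (f : hom A B)
    (g : hom B C) : exact_pair f g ->
  exists Q (q : hom B Q) (m : hom Q C),
    [/\ is_cokernel q f, is_mono m & m ∘ q = g].
Proof.
move=> [K [k [[Q [q [qf [qk kq]]]] [gk kg]]]].
have qP : is_epi q := cokernel_epi qf.
have [T [t [qt tq]]] := epi_is_cokernel qP.
have [t' [t'P _]] := kq _ _ qt.
have [|m [mq _]] := tq _ g; first by rewrite -t'P compA gk comp0m.
exists Q, q, m; split=> //; apply: is_mono0 => Z x mx.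
have [P [p pP]] := has_cokernel x.
have pE : is_epi p := cokernel_epi pP.
have [m' [m'p _]] := (proj2 pP) _ m mx.
have [S [h [pqh hU]]] := epi_is_cokernel (is_epi_comp qP pE).
have [|h' [h'P _]] := kg _ h.
  by rewrite -mq -m'p -!compA [p ∘ _]compA pqh compm0.
have [|r [rpq _]] := hU _ q; first by rewrite -h'P compA qk comp0m.
have rp : r ∘ p = idm Q by apply: qP; rewrite -compA rpq comp1m.
by rewrite -[x]comp1m -rp -compA (proj1 pP) compm0.
Qed.

Lemma mono_epi_section (Ab : abelian_category) (A B : Ab) (m : hom A B) :
  is_mono m -> is_epi m -> exists v : hom B A, m ∘ v = idm B.
Proof.
move=> mM mE; have [C [g [gm gU]]] := mono_is_kernel mM.
have [|v [mv _]] := gU _ (idm B); last by exists v.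
by rewrite compm1; apply: is_epi_eq0 gm.
Qed.

(** If the restriction of [g] to [U] is already epi, then [U] together with the
    image of [f] generates the middle term. *)
Lemma exact_pair_generate (Ab : abelian_category) (A B C U Z : Ab)
    (f : hom A B) (g : hom B C) (u : hom U B) (h : hom B Z) :
  exact_pair f g -> is_epi (g ∘ u) -> h ∘ f = 0 -> h ∘ u = 0 -> h = 0.
Proof.
move=> /exact_pair_factor [Q [q [m [[_ qU] mM mq]]]] guE hf hu.
have [h' [h'q _]] := qU _ h hf.
have muE : is_epi (m ∘ (q ∘ u)) by rewrite compA mq.
have [v mv] := mono_epi_section mM (is_epi_factor muE).
have vm : v ∘ m = idm Q by apply: mM; rewrite compA mv comp1m compm1.
have h'v : h' ∘ v = 0.
  apply: is_epi_eq0 muE _.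
  by rewrite compA -(compA h') vm compm1 compA h'q.
by rewrite -h'q -[h']compm1 -vm compA h'v !comp0m.
Qed.

(** * Extensions and their realizations *)

Lemma push0 (Cat : additive_category) (E : bifunctor Cat) (C A A' : Cat)
  (a : hom A A') : push a (0 : E C A) = 0.
Proof. by apply: (@addrI _ (push a 0)); rewrite -pushD !addr0. Qed.

Lemma pull0 (Cat : additive_category) (E : bifunctor Cat) (C C' A : Cat)
  (c : hom C' C) : pull c (0 : E C A) = 0.
Proof. by apply: (@addrI _ (pull c 0)); rewrite -pullD !addr0. Qed.

Lemma pull0m (Cat : additive_category) (E : bifunctor Cat) (C C' A : Cat)
  (d : E C A) : pull (0 : hom C' C) d = 0.
Proof. by apply: (@addrI _ (pull 0 d)); rewrite -pull_addm !addr0. Qed.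

Lemma pullB (Cat : additive_category) (E : bifunctor Cat) (C C' A : Cat)
  (c : hom C' C) (d d' : E C A) : pull c (d - d') = pull c d - pull c d'.
Proof. by apply: (@addIr _ (pull c d')); rewrite -pullD !subrK. Qed.

Lemma pull_subm (Cat : additive_category) (E : bifunctor Cat) (C C' A : Cat)
  (c c' : hom C' C) (d : E C A) : pull (c - c') d = pull c d - pull c' d.
Proof. by apply: (@addIr _ (pull c' d)); rewrite -pull_addm !subrK. Qed.

Lemma homotopy_equivalent_refl (Cat : additive_category) (n : nat) (A C : Cat)
  (X : cplx n A C) : homotopy_equivalent X X.
Proof.
have idP i j : (i + j)%N = n ->
    idm (X i.+1 j) ∘ diff X i j = diff X i j ∘ idm (X i j.+1).
  by move=> _; rewrite comp1m compm1.
pose f := ChainMap (cm := fun i j => idm (X i j)) idP.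
have ff : homotopic_to_id f f.
  exists (fun i j => 0); split=> [|i j _|]; rewrite /= comp1m subrr.
  - by rewrite comp0m.
  - by rewrite compm0 comp0m addr0.
  - by rewrite compm0.
by exists f, f.
Qed.

Lemma realization_ex (Cat : additive_category) (E : bifunctor Cat) (n : nat)
    (s : class_assignment E n) (hs : realization s) (A C : Cat) (d : E C A) :
  exists X, s C A d X.
Proof.
have [X sX] := rlz_class hs d; exists X.
by rewrite sX; apply: homotopy_equivalent_refl.
Qed.

(** The differential of the cone before the last has a row whose only nonzero
    entry comes from [X]; for [n = 0] it is a column, and the cone starts with
    it. *)
Lemma pr1_cone_diff (Cat : additive_category) (n : nat) (A C D : Cat)
    (X : cplx n.+1 A C) (Y : cplx n.+1 A D) (f : chain_map X Y) :
  exists m, pr1 (X n.+2 0) (Y n.+1 1) ∘ diff (cone f) n 1 = diff X n.+1 0 ∘ m.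
Proof.
case: n X Y f => [|k] X Y f /=.
  exists (- idm_or_0 (X 1%N) 1 1).
  by rewrite compA pr1_colm compNm compmN.
exists (- pr1 _ _).
by rewrite pr1_colm /rowm comp0m addr0 compNm compmN.
Qed.

Section Exangles.
Variables (Cat : additive_category) (E : bifunctor Cat) (n : nat).
Variables (s : class_assignment E n.+1) (hs : n_exangulated s).

Let hr : realization s := xr_realization (nx_exact hs).

Lemma pull_eq0P (A C W : Cat) (d : E C A) (X : cplx n.+1 A C) (v : hom W C) :
  s d X -> pull v d = 0 <-> exists u, diff X n.+1 0 ∘ u = v.
Proof. by move=> /(xr_exangle (nx_exact hs)) [_ /(_ W v)]. Qed.

Lemma push_eq0P (A C W : Cat) (d : E C A) (X : cplx n.+1 A C) (v : hom A W) :
  s d X -> push v d = 0 <-> exists u, u ∘ diff X 0 n.+1 = v.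
Proof. by move=> /(xr_exangle (nx_exact hs)) [_ _ _ /(_ W v)]. Qed.

Lemma pull_deflation (A C : Cat) (d : E C A) (X : cplx n.+1 A C) :
  s d X -> pull (diff X n.+1 0) d = 0.
Proof. by move=> sX; apply/(pull_eq0P _ sX); exists (idm _); rewrite compm1. Qed.

Lemma push_inflation (A C : Cat) (d : E C A) (X : cplx n.+1 A C) :
  s d X -> push (diff X 0 n.+1) d = 0.
Proof. by move=> sX; apply/(push_eq0P _ sX); exists (idm _); rewrite comp1m. Qed.

(** Exactness of the long sequence at E(W, A).  Let [r] on C + W restrict to [d]
    on C and to [th] on W.  The cone of a lift of (id, in1) carries the
    pushforward of [r], which is zero, so its deflation [in1, d_n^Y] splits; the
    component at W of a section expresses [in2], up to a multiple of [in1], as a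
    morphism that kills [r]. *)
Lemma push_inflation_eq0 (A C W : Cat) (d : E C A) (X : cplx n.+1 A C)
    (th : E W A) :
  s d X -> push (diff X 0 n.+1) th = 0 -> exists c, th = pull c d.
Proof.
move=> sX thX; pose r : E (C ⊞ W) A := pull (pr1 C W) d + pull (pr2 C W) th.
have r1 : pull (in1 C W) r = d.
  by rewrite pullD -!pull_comp pr1_in1 pr2_in1 pull1 pull0m addr0.
have r2 : pull (in2 C W) r = th.
  by rewrite pullD -!pull_comp pr1_in2 pr2_in2 pull1 pull0m add0r.
have [Y sY] := realization_ex hr r.
have sX' : s (pull (in1 C W) r) X by rewrite r1.
have [f [[_ f1] sM]] := nx_cone hs sX' sY.
have r0 : push (diff X 0 n.+1) r = 0.
  by rewrite pushD !push_pull thX (push_inflation sX) !pull0 addr0.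
have : pull (in2 C W) (push (diff X 0 n.+1) r) = 0 by rewrite r0 pull0.
move=> /(pull_eq0P _ sM) [w].
rewrite [diff _ _ _]/(rowm _ _) f1 compDl -!compA => in2E.
exists (pr1 _ _ ∘ w); rewrite -r1 -pull_comp; apply/subr0_eq.
rewrite -[in LHS]r2 -pull_subm -in2E addrAC subrr add0r.
by rewrite pull_comp (pull_deflation sY) pull0.
Qed.

(** * Restriction to an additive subfunctor *)

Section Restriction.
Variables (G : subfamily E) (hG : additive_subfunctor G).

Lemma restrict_mem (A C : Cat) (d : sub_bifunctor hG C A) :
  G (val (d : sub_ext hG C A)).
Proof. exact: set_mem (valP (d : sub_ext hG C A)). Qed.

Lemma restrict_lift (A C : Cat) (d : E C A) (X : cplx n.+1 A C) :
  s d X -> G d -> exists d', restrict s hG C A d' X.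
Proof. by move=> sX Gd; exists (Sub d (mem_set Gd) : sub_ext hG C A). Qed.

Lemma exact_realization_restrict : exact_realization (restrict s hG).
Proof.
split.
- split=> [C A d|C A C' A' d r X Y a c sX sY e].
    exact: (rlz_class hr (val d)).
  exact: (rlz_lift hr sX sY (congr1 val e)).
- move=> C A d X /(xr_exangle (nx_exact hs)) [X1 X2 X3 X4]; split=> // W v.
    rewrite -X2; split=> [/(congr1 val) //|e].
    exact: val_inj.
  rewrite -X4; split=> [/(congr1 val) //|e].
  exact: val_inj.
- exact: (xr_trivl (nx_exact hs)).
- exact: (xr_trivr (nx_exact hs)).
Qed.

(** By long exactness the extensions killed by an inflation are the pullbacks of
    any one of its extensions, so whether this one belongs to [G] does not
    depend on the choice, and can be said without mentioning it. *)
Lemma inflation_restrictP (A B : Cat) (f : hom A B) :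
  inflation (restrict s hG) f <->
  inflation s f /\ forall C (d : E C A), push f d = 0 -> G d.
Proof.
split=> [[C A' d X sX]|[]].
  split=> [|W th th0]; first exact: (Inflation (s := s) sX).
  have [c ->] := push_inflation_eq0 sX th0.
  exact/(sub_pull hG)/restrict_mem.
case=> C A' d X sX GX.
have [d' sX'] := restrict_lift sX (GX _ _ (push_inflation sX)).
exact: (Inflation (s := restrict s hG) sX').
Qed.

(** Closedness is a matter of inflations and deflations only: the mapping cones
    and cocones carry pushforwards and pullbacks of extensions of [G]. *)
Lemma n_exangulated_restrict :
  (forall A B C (f : hom A B) (g : hom B C),
    inflation (restrict s hG) f -> inflation (restrict s hG) g ->
    inflation (restrict s hG) (g ∘ f)) ->
  (forall A B C (f : hom A B) (g : hom B C),
    deflation (restrict s hG) f -> deflation (restrict s hG) g ->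
    deflation (restrict s hG) (g ∘ f)) ->
  n_exangulated (restrict s hG).
Proof.
move=> infl defl; split=> // [|A C D r c X Y sX sY|A B C r a X Y sX sY].
- exact: exact_realization_restrict.
- exact: (nx_cone hs (r := val r) sX sY).
- exact: (nx_cocone hs (r := val r) sX sY).
Qed.

End Restriction.

(** * The right exact part *)

Section HalfExact.
Variables (Ab : abelian_category) (F : additive_functor Cat Ab).

Local Notation ER := (right_exact_part s F).

(** Realizations disappear from the condition: [diff X n.+1 0] kills [d], and
    every [t] that kills [d] factors through it. *)
Lemma right_exact_partP (A C : Cat) (d : E C A) :
  ER C A d <-> exists T (t : hom T C), is_epi (fmap F t) /\ pull t d = 0.
Proof.
split=> [dR | [T [t [tE td]]] X sX].
  have [X sX] := realization_ex hr d.
  by exists _, (diff X n.+1 0); split; [apply: dR | apply: pull_deflation].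
have [u tu] := proj1 (pull_eq0P t sX) td.
by apply: is_epi_factor (fmap F u) _ _; rewrite -fmap_comp tu.
Qed.

Lemma right_exact_part_deflation (A C : Cat) (d : E C A) (X : cplx n.+1 A C) :
  s d X -> is_epi (fmap F (diff X n.+1 0)) -> ER C A d.
Proof.
move=> sX dE; apply/right_exact_partP.
by exists _, (diff X n.+1 0); split=> //; apply: pull_deflation.
Qed.

Lemma right_exact_part_local (A C T : Cat) (t : hom T C) (d : E C A) :
  is_epi (fmap F t) -> ER T A (pull t d) -> ER C A d.
Proof.
move=> tE /right_exact_partP [T' [t' [t'E t'd]]]; apply/right_exact_partP.
exists T', (t ∘ t'); split; first by rewrite fmap_comp; apply: is_epi_comp.
by rewrite pull_comp.
Qed.

Lemma right_exact_part_push (A A' C : Cat) (a : hom A A') (d : E C A) :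
  ER C A d -> ER C A' (push a d).
Proof.
move=> /right_exact_partP [T [t [tE td]]]; apply/right_exact_partP.
by exists T, t; split=> //; rewrite -push_pull td push0.
Qed.

Hypothesis hF : half_exact s F.

(** A morphism [g] on F C' that vanishes on F d_n^X extends by zero to the last
    middle term F C' + F Y_n of the cone and then vanishes on the image of the
    preceding differential; as F Y_n already covers F C, this forces [g] = 0. *)
Lemma right_exact_part_pull (A C C' : Cat) (c : hom C' C) (d : E C A) :
  ER C A d -> ER C' A (pull c d).
Proof.
move=> dR X sX; have [Y sY] := realization_ex hr d.
have [f [_ sM]] := nx_cone hs sX sY.
have MP := hF sM (congr1 S (addn0 n)).
apply: is_epi0 => Z g gX.
set p := pr1 (X n.+2 0) (Y n.+1 1%N).
suff gp : g ∘ fmap F p = 0.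
  by rewrite -[g]compm1 -fmap1 -(pr1_in1 _ (Y n.+1 1%N)) fmap_comp compA gp comp0m.
apply: (exact_pair_generate MP (u := fmap F (in2 _ _))).
- rewrite -fmap_comp [diff _ _ _]/(rowm _ _) compDl -!compA pr1_in2 pr2_in2.
  by rewrite compm0 add0r compm1; apply: dR.
- rewrite -compA -fmap_comp.
  by have [m ->] := pr1_cone_diff f; rewrite fmap_comp compA gX comp0m.
- by rewrite -compA -fmap_comp pr1_in2 fmap0 compm0.
Qed.

Lemma right_exact_part_additive : additive_subfunctor ER.
Proof.
split=> [C A|C A d d' dR d'R|C A A' a d|C C' A c d].
- apply/right_exact_partP; exists C, (idm C); split; last exact: pull0.
  by move=> Z g h; rewrite fmap1 !compm1.
(* A common [t] is obtained by killing [d] first, then the pullback of [d']. *)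
- have [T [t [tE td]]] := proj1 (right_exact_partP d) dR.
  apply: (right_exact_part_local tE); rewrite pullB td.
  have [T' [t' [t'E t'd]]] := proj1 (right_exact_partP _)
    (right_exact_part_pull (c := t) d'R).
  apply/right_exact_partP; exists T', t'; split=> //.
  by rewrite pullB pull0 t'd subrr.
- exact: right_exact_part_push.
- exact: right_exact_part_pull.
Qed.

Lemma deflation_right_exactP (hR : additive_subfunctor ER) (B C : Cat)
    (g : hom B C) :
  deflation (restrict s hR) g <-> deflation s g /\ is_epi (fmap F g).
Proof.
split=> [[C' A d X sX]|[]].
  split; first exact: (Deflation (s := s) sX).
  exact: (restrict_mem d).
case=> C' A d X sX gE.
have [d' sX'] := restrict_lift hR sX (right_exact_part_deflation sX gE).
exact: (Deflation (s := restrict s hR) sX').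
Qed.

Lemma right_exact_part_closed : closed_subfunctor s ER.
Proof.
have hR := right_exact_part_additive; exists hR.
apply: n_exangulated_restrict => A B C f g.
- move=> /inflation_restrictP [fI fR] /inflation_restrictP [gI gR].
  apply/inflation_restrictP; split=> [|W d]; first exact: (nx_infl_comp hs).
  rewrite push_comp => /gR /right_exact_partP [T [t [tE td]]].
  by apply: (right_exact_part_local tE); apply: fR; rewrite push_pull.
- move=> /deflation_right_exactP [fD fE] /deflation_right_exactP [gD gE].
  apply/deflation_right_exactP; split; first exact: (nx_defl_comp hs).
  by rewrite fmap_comp; apply: is_epi_comp.
Qed.

End HalfExact.
End Exangles.

End RightExactPart.

Theorem theorem4p5 (n : nat) (n_ge1 : (1 <= n)%N)
    (Cat : additive_category) (E : bifunctor Cat) (s : class_assignment E n)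
    (hs : n_exangulated s) (Ab : abelian_category)
    (F : additive_functor Cat Ab) (hF : half_exact s F) :
  exists hR : closed_subfunctor s (right_exact_part s F),
    right_exact (relative_theory hR) F /\
    forall (G : subfamily E) (hG : closed_subfunctor s G),
      right_exact (relative_theory hG) F ->
      forall C A : Cat, (G C A `<=` right_exact_part s F C A)%classic.
Proof.
(* Degrees [n] and [n - 1] are both needed, so the lemmas are about [n.+1]. *)
case: n n_ge1 s hs hF => // n _ s hs hF.
exists (right_exact_part_closed hs hF); split.
  split=> [C A d X sX|C A d X sX]; first exact: (hF _ _ _ _ sX).
  exact: (restrict_mem d).
move=> G hG [_ GE] C A d Gd X sX.
have [d' sX'] := restrict_lift (cs_additive hG) sX Gd.
exact: GE sX'.
Qed.
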